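(* $\operatorname{add}(\mathcal{N})_{\mathrm{game}}^{\mathrm{II}} = \operatorname{cov}(\mathcal{M})$.
   Context: $\operatorname{cov}(\mathcal{M})$ is the least number of meager sets needed to cover $2^\omega$. For $k\in\omega$, $[\omega]^{k+1}$ denotes the set of subsets of $\omega$ of size $k+1$. For $\mathcal{A}\subseteq\omega^\omega$, the anti-localizing game with respect to $\mathcal{A}$: at round $k$, Player I plays $a_k\in[\omega]^{k+1}$ and then Player II plays $i_k\in\{0,1\}$. Player II wins iff $i_k=1$ for infinitely many $k$ and there is $x\in\mathcal{A}$ with $\{k: i_k=1\}=\{k: x(k)\notin a_k\}$. $\operatorname{add}(\mathcal{N})_{\mathrm{game}}^{\mathrm{II}}$ is the least $|\mathcal{A}|$ such that Player II has a winning strategy in the anti-localizing game with respect to $\mathcal{A}$. *)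

(* Defs.v *)
From HB Require Import structures.
From mathcomp Require Import all_boot all_order all_algebra.
From mathcomp Require Import all_classical all_reals all_analysis.
Set Implicit Arguments. Unset Strict Implicit. Unset Printing Implicit Defensive.
Local Open Scope classical_set_scope.

Definition nowhere_dense {T : topologicalType} (N : set T) : Prop :=
  (closure N)^° = set0.

Definition meager {T : topologicalType} (M : set T) : Prop :=
  exists F : nat -> set T, (forall n, nowhere_dense (F n)) /\ M `<=` \bigcup_n F n.

Definition legal_move (k : nat) (a : set nat) : Prop :=
  exists s : seq nat, uniq s /\ size s = k.+1 /\ a = [set n | n \in s].

(** A strategy for Player II: given the history (a_0, ..., a_k) of Player I's
    moves (Player II's own earlier moves are determined by the strategy),
    it returns i_k (true = 1, false = 0). *)
Definition strategyII := seq (set nat) -> bool.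

Definition resp (sigma : strategyII) (a : nat -> set nat) (k : nat) : bool :=
  sigma (mkseq a k.+1).

Definition winning_II (A : set (nat -> nat)) (sigma : strategyII) : Prop :=
  forall a : nat -> set nat, (forall k, legal_move k (a k)) ->
    (forall m, exists k, (m <= k)%N /\ resp sigma a k = true) /\
    exists2 x, A x & forall k, resp sigma a k = true <-> ~ a k (x k).

Definition II_has_winning (A : set (nat -> nat)) : Prop :=
  exists sigma, winning_II A sigma.

(* Main.v *)
Require Import Defs.
From HB Require Import structures.
From mathcomp Require Import all_boot all_order all_algebra.
From mathcomp Require Import all_classical all_reals all_analysis.
From mathcomp Require Import zify.
Local Open Scope classical_set_scope.

(** cov(M) <= add(N)_game^II: once II's strategy and a witness [x] are fixed, the
    plays of Player I for which [x] is a correct witness form a nowhere dense set,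
    since from any position Player I may keep [x k] in [a k] forever, and the
    strategy must nevertheless answer [1] again.

    add(N)_game^II <= cov(M): a meager set [M i] gives words [y i m] such that no
    point of [M i] reads [y i m] at position [m] for infinitely many [m]. From a
    cover by such sets one gets equally many functions such that every slalom of
    polynomial width is eventually avoided by one of them. Either the growth of
    the words is dominating, and so fast functions do it; or a single interval
    partition [j] is such that each [i] has infinitely many [k] whose word
    [y i (j k)] fits in [[j k, j k.+1)]. Then the [k]-th value of the function
    of [i] codes many such words, and a slalom capturing all functions infinitely
    often would allow to build a point outside every [M i]. *)

(** * Cylinders and meager sets in the Cantor space *)

Definition agree {T : Type} (L : nat) (z z' : nat -> T) : Prop :=
  forall i, (i < L)%N -> z i = z' i.

Definition matches (m : nat) (t : seq bool) (z : nat -> bool) : Prop :=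
  forall l, (l < size t)%N -> z (m + l)%N = nth false t l.

Lemma nbhs_cantorP (z : cantor_space) (U : set cantor_space) :
  nbhs z U <-> exists L, [set z' | agree L z z'] `<=` U.
Proof.
split=> [zU|[L LU]].
  pose F := filter_from [set: nat] (fun L => [set z' : cantor_space | agree L z z']).
  have FF : Filter F.
    apply: filter_from_filter; first by exists 0%N.
    move=> i j _ _; exists (maxn i j) => // z' zz'; split=> k ki; apply: zz';
      by rewrite leq_max ki ?orbT.
  have Fz : F --> z.
    apply/cvg_sup => i V [/= _ [[B oB <-] Bz] /filterS]; apply.
    by exists i.+1 => // z' zz' /=; rewrite /proj /= -zz'.
  by have [L _ LU] := Fz _ zU; exists L.
apply: filterS LU _; elim: L => [|L IH].
  by apply: filterS filterT => z' _ i.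
have : nbhs z [set z' : cantor_space | z L = z' L].
  have := @proj_continuous nat (fun _ => bool) L z [set z L].
  have zL : nbhs (proj L z) [set z L] by exact: discrete_set1.
  by move=> /(_ zL); apply: filterS => z' /= ->.
move=> /(filterI IH); apply: filterS => z' [zz' zL] i.
by rewrite ltnS leq_eqVlt => /predU1P[->|/zz'].
Qed.

Lemma nowhere_dense_cylinder (N : set cantor_space) (s : seq bool) :
  nowhere_dense N ->
  exists t, forall z : cantor_space, matches 0 (s ++ t) z -> ~ N z.
Proof.
move=> Nnd; pose z0 : cantor_space := nth false s.
have nint : ~ nbhs z0 (closure N).
  by move=> z0N; have : (closure N)^° z0 by []; rewrite Nnd.
have z0s : nbhs z0 [set z | matches 0 s z].
  by apply/nbhs_cantorP; exists (size s) => z zz i si; rewrite add0n -zz.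
have [z1 [z1s z1N]] : exists z1 : cantor_space, matches 0 s z1 /\ ~ closure N z1.
  apply: contrapT => H; apply: nint; apply: filterS z0s => z zs.
  by apply: contrapT => zN; apply: H; exists z.
have [U [/nbhs_cantorP[L LU] UN]] : exists U, nbhs z1 U /\ forall z, U z -> ~ N z.
  apply: contrapT => H; apply: z1N => U zU; apply: contrapT => NU; apply: H.
  by exists U; split=> // z Uz Nz; apply: NU; exists z.
exists (mkseq (fun i => z1 (size s + i)%N) L) => z zm; apply: UN; apply: LU => i iL.
case: (ltnP i (size s)) => si.
  have := zm i; have := z1s i si; rewrite !add0n size_cat nth_cat si => -> -> //; lia.
have := zm i; rewrite add0n size_cat size_mkseq nth_cat (leq_gtF si) => ->; last by lia.
rewrite nth_mkseq ?subnKC //; lia.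
Qed.

(** [y m] serves all words of length [m] at once: successive extensions make it leave [F 0], ...,
    [F m] whatever the first [m] bits are. *)
Lemma meager_avoid (M : set cantor_space) :
  meager M ->
  exists y : nat -> seq bool, forall z : cantor_space, M z ->
    exists K, forall m, (K <= m)%N -> ~ matches m (y m) z.
Proof.
case=> F [Fnd MF].
have step (L : seq (seq bool * nat)) (t0 : seq bool) : exists t,
    forall p, p \in L -> forall z : cantor_space,
      matches 0 (p.1 ++ (t0 ++ t)) z -> ~ F p.2 z.
  elim: L t0 => [|[s n] L IH] t0; first by exists [::].
  have [t1 t1N] := nowhere_dense_cylinder _ (s ++ t0) (Fnd n).
  have [t2 t2N] := IH (t0 ++ t1).
  exists (t1 ++ t2) => p; rewrite inE => /predU1P[->|pL] z /=.
    rewrite !catA => zm; apply: t1N => l lt; have := zm l.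
    by rewrite nth_cat lt; apply; rewrite size_cat; lia.
  by move: (t2N p pL z); rewrite !catA.
have /choice[y yP] (m : nat) : exists t, forall n (z : cantor_space),
    (n <= m)%N -> matches m t z -> ~ F n z.
  pose L := [seq (val s, n) | s <- enum {: m.-tuple bool}, n <- iota 0 m.+1].
  have [t tP] := step L [::]; exists t => n z nm zt.
  have sz : size (mkseq z m) == m by rewrite size_mkseq.
  have /tP : (mkseq z m, n) \in L.
    apply/allpairsP; exists (Tuple sz, n).
    by split; [rewrite mem_enum|rewrite mem_iota|].
  apply=> l /=; rewrite size_cat nth_cat size_mkseq add0n => lt.
  case: ltnP => [lm|ml]; first by rewrite nth_mkseq.
  by rewrite -{1}(subnKC ml) zt //; lia.
exists y => z /MF[n _ Fnz]; exists n => m nm zm.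
exact: (yP m n z).
Qed.

(** * Plays coded by points, and the cover given by a strategy *)

(** A point of the Cantor space with infinitely many ones codes the sequence of
    the lengths of its blocks of zeros; [gap] is [0] when no further one occurs. *)
Definition gap (c : nat -> bool) (p : nat) : nat :=
  if pselect (exists i, c (p + i)%N) is left e then ex_minn e else 0%N.

Fixpoint pos (c : nat -> bool) (k : nat) : nat :=
  if k is k'.+1 then (pos c k' + gap c (pos c k')).+1 else 0%N.

Definition move (c : nat -> bool) (k : nat) : set nat :=
  [set n | n \in iota (gap c (pos c k)) k.+1].

Lemma legal_move_move c k : legal_move k (move c k).
Proof.
by exists (iota (gap c (pos c k)) k.+1); rewrite iota_uniq size_iota.
Qed.

Lemma gapE c p n :
  (forall i, (i < n)%N -> c (p + i)%N = false) -> c (p + n)%N -> gap c p = n.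
Proof.
move=> cn cpn; rewrite /gap; case: pselect => [e|[]]; last by exists n.
case: ex_minnP => m cm mn; apply/eqP; rewrite eqn_leq mn //= leqNgt.
by apply/negP => /cn; rewrite cm.
Qed.

Definition inf_ones (c : nat -> bool) := forall p, exists i, c (p + i)%N.

Lemma pos_agree c c' k : inf_ones c -> agree (pos c k) c c' -> pos c' k = pos c k.
Proof.
move=> cinf; elim: k => // k IH /= cc'.
have pk : pos c' k = pos c k by apply: IH => i ik; apply: cc'; lia.
rewrite pk; congr (_ + _).+1.
move: cc'; rewrite {1}/gap; case: pselect => [e|/(_ (cinf _))//].
case: ex_minnP => m cm mn cc'.
rewrite (gapE c _ m) //; last first.
  by move=> i im; apply/negbTE/negP => /mn; lia.
apply: gapE; last by rewrite -cc'.
move=> i im; rewrite -cc'; last by lia.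
by apply/negbTE/negP => /mn; lia.
Qed.

Lemma pos_mono c : {homo pos c : k l / (k <= l)%N}.
Proof.
apply: homo_leq => [//|m n p|k /=]; first exact: leq_trans.
lia.
Qed.

Lemma pos_ge c k : (k <= pos c k)%N.
Proof. elim: k => //= k; lia. Qed.

(** Each gap is read off from two consecutive positions, so finitely many bits fix the moves, even
    if [c'] has only finitely many ones. *)
Lemma move_agree c c' k l : inf_ones c -> (l <= k)%N ->
  agree (pos c k.+1) c c' -> move c' l = move c l.
Proof.
move=> cinf lk cc'.
have E i : (i <= k.+1)%N -> pos c' i = pos c i.
  move=> ik; apply: pos_agree => // j ji; apply: cc'.
  by apply: leq_trans ji _; exact: pos_mono.
have := E l.+1; rewrite /= E; last by lia.
by rewrite /move (E l); last lia; move=> /(_ lk)[] /addnI ->.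
Qed.

Lemma nowhere_dense_consistent (sigma : strategyII) (x : nat -> nat) :
  (forall a, (forall k, legal_move k (a k)) ->
     forall m, exists k, (m <= k)%N /\ resp sigma a k = true) ->
  nowhere_dense [set c : cantor_space |
     forall k, resp sigma (move c) k = true <-> ~ move c k (x k)].
Proof.
set N := [set c | _] => Hinf.
apply/seteqP; split=> // c0 /nbhs_cantorP[L LN].
(* Ones after the prescribed bits close the first [L] blocks; they end at [P], which is at least
   [L]. *)
pose c1 i := if (i < L)%N then c0 i else true.
have c1inf : inf_ones c1 by move=> p; exists L; rewrite /c1 ltnNge leq_addl.
pose P := pos c1 L.
(* From block [L] on, [c] will have the gaps [x L], [x L.+1], ..., so that each move contains the
   value of [x]. *)
pose Q := fix Q j := if j is j'.+1 then (Q j' + x (L + j')%N).+1 else P.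
have Qmono : {homo Q : i j / (i <= j)%N}.
  by apply: homo_leq => [//|m n p|k /=]; [exact: leq_trans|lia].
have QP j : (P + j <= Q j)%N by elim: j => [|j] /=; lia.
pose c i := if (i < P)%N then c1 i else `[< exists j, i = (Q j + x (L + j))%N >].
have cQ j : c (Q j + x (L + j))%N.
  by rewrite /c ifN; [apply/asboolP; exists j|have := QP j; lia].
have cinf : inf_ones c.
  move=> p; exists (Q p + x (L + p) - p)%N.
  by rewrite subnKC //; have := QP p; lia.
have posQ j : pos c (L + j) = Q j /\ gap c (Q j) = x (L + j)%N.
  have gQ l : gap c (Q l) = x (L + l)%N.
    apply: gapE => // i il; rewrite /c ifN; last by have := QP l; lia.
    apply/asboolP => -[m]; case: (ltngtP m l) => ml; last by rewrite ml; lia.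
      by have := Qmono _ _ ml; rewrite /=; lia.
    by have := Qmono _ _ ml; rewrite /=; lia.
  split=> //; elim: j => [|j IH]; last by rewrite addnS /= IH gQ.
  by rewrite addn0; apply: pos_agree => // i iP; rewrite /c iP.
have [k [Lk rk]] := Hinf (move c) (legal_move_move c) L.
have ck : move c k (x k).
  have [] := posQ (k - L)%N; rewrite subnKC // => E1 E2.
  by rewrite /move /= E1 E2 inE eqxx.
have cN : closure N c.
  by apply: LN => i iL; rewrite /c /c1 iL ifT //; apply: leq_trans iL _; exact: pos_ge.
(* A point of [N] near [c] has the same moves up to [k], hence the same answer [1], although [x k]
   lies in the move. *)
have [c' [c'N cc']] : N `&` [set c' | agree (pos c k.+1) c c'] !=set0.
  by apply: cN; apply/nbhs_cantorP; exists (pos c k.+1).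
have Ek l : (l <= k)%N -> move c' l = move c l by move=> lk; exact: (move_agree _ _ k).
have := c'N k; rewrite /resp (_ : mkseq (move c') k.+1 = mkseq (move c) k.+1).
  by rewrite Ek // => -[/(_ rk)].
by apply/eq_in_map => l; rewrite mem_iota => /andP[_ lk]; exact: Ek.
Qed.

Lemma cover_of_winning_II (A : set (nat -> nat)) : II_has_winning A ->
  exists (I : Type) (M : I -> set cantor_space),
    (forall i, meager (M i)) /\ \bigcup_(i in [set: I]) M i = [set: cantor_space] /\
    exists f : I -> {x : nat -> nat | A x}, injective f.
Proof.
case=> sigma win; exists {x : nat -> nat | A x}.
exists (fun x => [set c : cantor_space |
  forall k, resp sigma (move c) k = true <-> ~ move c k (sval x k)]).
split=> [x|]; last split; last by exists id.
  eexists (fun=> _); split; last by move=> c cx; exists 0%N => //; exact: cx.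
  by move=> _; apply: nowhere_dense_consistent => a la; have [] := win a la.
apply/seteqP; split=> // c _.
have [_ [x Ax xc]] := win _ (legal_move_move c).
by exists (exist _ x Ax).
Qed.

(** * From a meager cover to evasive functions *)

(** Treats the candidates in order, picking from the [p]-th one a pair whose key
    differs from the at most [p] keys picked so far. *)
Lemma greedy_transversal (T : eqType) (cand : nat -> seq (nat * T)) :
  exists W : nat -> T -> Prop,
    (forall s t t', W s t -> W s t' -> t = t') /\
    forall p, uniq (unzip1 (cand p)) -> (p < size (cand p))%N ->
      exists s t, (s, t) \in cand p /\ W s t.
Proof.
pose st := fix st p : seq (nat * T) := if p is p'.+1 then
  (if [seq u <- cand p' | u.1 \notin unzip1 (st p')] is u :: _ then u :: st p' else st p')
  else [::].
have stS p : st p.+1 =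
  (if [seq u <- cand p | u.1 \notin unzip1 (st p)] is u :: _ then u :: st p else st p).
  by [].
have mono : {homo st : p q / (p <= q)%N >-> {subset p <= q}}.
  apply: homo_leq => [p u //|p q r qp pr u /qp/pr //|p u]; rewrite stS.
  by case: [seq _ <- _ | _] => // v r up; rewrite inE up orbT.
have size_st p : (size (st p) <= p)%N.
  by elim: p => // p IH; rewrite stS; case: [seq _ <- _ | _] => [|v r] //=; exact: leqW.
have fct p s t t' : (s, t) \in st p -> (s, t') \in st p -> t = t'.
  elim: p => // p IH; rewrite stS.
  case E: [seq _ <- _ | _] => [|v r]; first exact: IH.
  have : v \in v :: r by rewrite mem_head.
  rewrite -E mem_filter => /andP[vp _].
  rewrite !inE => /predU1P[sv|st1] /predU1P[sv'|st2].
  - by move: sv'; rewrite -sv => -[].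
  - by move: vp; rewrite -sv => /mapP[]; exists (s, t').
  - by move: vp; rewrite -sv' => /mapP[]; exists (s, t).
  - exact: IH.
exists (fun s t => exists p, (s, t) \in st p); split.
  move=> s t t' [p sp] [q sq]; apply: (fct (maxn p q) s).
    by apply: mono sp; exact: leq_maxl.
  by apply: mono sq; exact: leq_maxr.
move=> p up szp.
case E: [seq u <- cand p | u.1 \notin unzip1 (st p)] => [|[s t] r]; last first.
  exists s, t; split; last by exists p.+1; rewrite stS E mem_head.
  have : (s, t) \in (s, t) :: r by rewrite mem_head.
  by rewrite -E mem_filter => /andP[].
have sub : {subset unzip1 (cand p) <= unzip1 (st p)}.
  move=> _ /mapP[u up' ->]; apply: contraT => un.
  have : u \in [seq u <- cand p | u.1 \notin unzip1 (st p)] by rewrite mem_filter un.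
  by rewrite E.
have := uniq_leq_size up sub; rewrite !size_map; have := size_st p; lia.
Qed.

Definition strictly_increasing (j : nat -> nat) := forall k, (j k < j k.+1)%N.

Lemma strictly_increasing_homo j : strictly_increasing j ->
  {homo j : k l / (k < l)%N}.
Proof. by move=> jS; apply: homo_ltn => // k l m; exact: ltn_trans. Qed.

Lemma strictly_increasing_ge j k : strictly_increasing j -> (k <= j k)%N.
Proof. by move=> jS; elim: k => // k IH; exact: leq_ltn_trans IH (jS k). Qed.

Lemma strictly_increasing_slot j m K : strictly_increasing j -> (j K <= m)%N ->
  exists k, (K <= k)%N /\ (j k <= m < j k.+1)%N.
Proof.
move=> jS; elim: m => [|m IH] jK.
  by exists K; rewrite leqnn jK; have := jS K; lia.
move: jK; rewrite leq_eqVlt => /predU1P[<-|]; first by exists K; rewrite !leqnn jS.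
rewrite ltnS => /IH[k [Kk /andP[jk mk]]].
case: (ltngtP m.+1 (j k.+1)) => mk'; last by exists k.+1; rewrite mk' leqnn jS; lia.
  by exists k; rewrite Kk mk' leqW.
lia.
Qed.

Definition evasive {I : Type} (h : nat -> nat) (x : I -> nat -> nat) : Prop :=
  forall b : nat -> seq nat, (forall k, (size (b k) <= h k)%N) ->
    exists i K, forall k, (K <= k)%N -> x i k \notin b k.

(** Let [j] outgrow the entries of [b]. For large [k] and [j k <= m < j k.+1], one application of
    [e i] to [m] passes [j k.+1] and the second passes [j k.+2], which exceeds every entry of
    [b m]. *)
Lemma evasive_of_dominating (I : Type) (h : nat -> nat) (e : I -> nat -> nat) :
  (forall i, {homo e i : m n / (m <= n)%N}) ->
  (forall j, strictly_increasing j ->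
    exists i K, forall k, (K <= k)%N -> (j k.+1 < e i (j k))%N) ->
  evasive h (fun i m => e i (e i m)).
Proof.
move=> emono edom b _.
pose g m := \max_(k < m.+1) \max_(n <- b k) n.
pose j := fix j k := if k is k'.+1 then (g (j k') + j k').+1 else 0%N.
have jS : strictly_increasing j by move=> k /=; lia.
have gb m k n : (k <= m)%N -> n \in b k -> (n <= g m)%N.
  move=> km nb; rewrite /g.
  apply: (leq_trans (@leq_bigmax_seq _ (b k) xpredT (fun n => n) n nb isT)).
  exact: (@leq_bigmax_cond _ xpredT (fun k : 'I_m.+1 => \max_(n <- b k) n)
    (Ordinal (km : (k < m.+1)%N))).
have [i [K iK]] := edom j jS.
exists i, (j K) => m Km; apply/negP => xb.
have [k [Kk /andP[jk mk]]] := strictly_increasing_slot _ _ _ jS Km.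
have e1 := emono i _ _ jk.
have e2 := leq_trans (iK k Kk) e1.
have e3 := emono i _ _ (ltnW e2).
have e4 := leq_trans (iK k.+1 (leqW Kk)) e3.
have := gb (j k.+1) m (e i (e i m)) (ltnW mk) xb.
have jE : j k.+2 = (g (j k.+1) + j k.+1).+1 by [].
move: e4; rewrite jE; lia.
Qed.

(** Were every function captured infinitely often, the entries of [b] would decode to lists of words
    with their slots. Choosing from them one word per slot gives a [z] that matches words of every
    [i] arbitrarily late. *)
Lemma evasive_of_slots (I : Type) (h : nat -> nat) (y : I -> nat -> seq bool)
    (j : nat -> nat) :
  strictly_increasing j ->
  (forall i K, exists k, (K <= k)%N /\ (j k + size (y i (j k)) <= j k.+1)%N) ->
  (forall z, exists i K, forall m, (K <= m)%N -> ~ matches m (y i m) z) ->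
  exists x : I -> nat -> nat, evasive h x.
Proof.
move=> jS yinf ycov.
have /choice[nxt nxtP] (u : I * nat) : exists k, (u.2 <= k)%N /\
    (j k + size (y u.1 (j k)) <= j k.+1)%N by exact: yinf.
(* [sl i k] enumerates increasingly slots from [k] on in which the word of [i] fits. *)
pose sl i k := fix sl n := if n is n'.+1 then nxt (i, (sl n').+1) else nxt (i, k).
have slS i k : {homo sl i k : m n / (m < n)%N}.
  apply: homo_ltn => [l m n|n /=]; first exact: ltn_trans.
  by have [] := nxtP (i, (sl i k n).+1).
have sl_ge i k n : (k <= sl i k n)%N.
  have k0 : (k <= sl i k 0)%N by have [] := nxtP (i, k).
  by case: n => // n; apply: leq_trans k0 (ltnW (slS i k _ _ _)).
have slX i k n : (j (sl i k n) + size (y i (j (sl i k n))) <= j (sl i k n).+1)%N.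
  case: n => [|n] /=; first by have [] := nxtP (i, k).
  by have [] := nxtP (i, (sl i k n).+1).
(* [guess i k] is long enough for [greedy_transversal] to succeed when it is the
   candidate of index [pickle (k, q)], whatever its place [q < h k] in [b k]. *)
pose len k := \max_(q < h k) (pickle (k, q : nat)).+1.
pose guess i k := [seq (sl i k n, y i (j (sl i k n))) | n <- iota 0 (len k)].
exists (fun i k => pickle (guess i k)) => b bh.
apply: contrapT => H.
have {}H i K : exists k, (K <= k)%N /\ pickle (guess i k) \in b k.
  apply: contrapT => H'; apply: H; exists i, K => k Kk; apply/negP => kb.
  by apply: H'; exists k.
pose cand p : seq (nat * seq bool) :=
  if unpickle p is Some (k, q) then odflt [::] (unpickle (nth 0%N (b k) q)) else [::].
have [W [Wfun Wcand]] := greedy_transversal _ cand.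
pose z n := `[< exists s t, W s t /\ (j s <= n < j s.+1)%N /\ nth false t (n - j s) >].
have [i [K iK]] := ycov z.
have [k [Kk kb]] := H i K.
pose q := index (pickle (guess i k)) (b k).
have qh : (q < h k)%N by apply: leq_trans (bh k); rewrite index_mem.
have candE : cand (pickle (k, q)) = guess i k.
  by rewrite /cand pickleK nth_index // pickleK.
have [] := Wcand (pickle (k, q)).
- rewrite candE /unzip1 -map_comp map_inj_uniq ?iota_uniq //.
  by move=> u v /= uv; case: (ltngtP u v) => // /(slS i k); rewrite /= uv ltnn.
- rewrite candE size_map size_iota.
  exact: (@leq_bigmax_cond _ xpredT (fun q : 'I_(h k) => (pickle (k, q : nat)).+1) (Ordinal qh)).
move=> s [t [st Wst]]; move: st; rewrite candE => /mapP[n _ [sE tE]].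
have js : (K <= j s)%N.
  apply: leq_trans Kk _; apply: leq_trans (sl_ge i k n) _.
  by rewrite -sE; exact: strictly_increasing_ge.
apply: (iK _ js) => l ls.
have jl : (j s <= j s + l < j s.+1)%N.
  by have := slX i k n; rewrite -sE; lia.
rewrite -sE in tE; rewrite -tE.
(* Slots are disjoint and [W] allows one word per slot, so no other word interferes. *)
apply/idP/idP => [/asboolP[s' [t' [Wst' [jl' zt]]]]|zt]; last first.
  by apply/asboolP; exists s, t; rewrite addKn.
have ss' : s' = s.
  have hj k1 k2 : (k1 < k2)%N -> (j k1.+1 <= j k2)%N.
    by rewrite leq_eqVlt => /predU1P[->//|/(strictly_increasing_homo _ jS)/ltnW].
  by case: (ltngtP s' s) => // /hj; lia.
by move: zt; rewrite ss' in Wst' *; rewrite (Wfun _ _ _ Wst Wst') addKn.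
Qed.

Lemma evasive_of_cover (I : Type) (h : nat -> nat) (M : I -> set cantor_space) :
  (forall i, meager (M i)) -> \bigcup_(i in [set: I]) M i = [set: cantor_space] ->
  exists x : I -> nat -> nat, evasive h x.
Proof.
move=> Mmeager Mcov.
have /choice[y yP] i := meager_avoid _ (Mmeager i).
have ycov z : exists i K, forall m, (K <= m)%N -> ~ matches m (y i m) z.
  have : (\bigcup_(i in [set: I]) M i) z by rewrite Mcov.
  by case=> i _ /yP; exists i.
(* The furthest end of a word of [i] placed at or before [m]. *)
pose e i m := \max_(n < m.+1) (n + size (y i n))%N.
have e_ge i m n : (n <= m)%N -> (n + size (y i n) <= e i m)%N.
  move=> nm; rewrite /e.
  exact: (@leq_bigmax_cond _ xpredT (fun n : 'I_m.+1 => n + size (y i n))%N (Ordinal (nm : n < m.+1)%N)).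
have emono i : {homo e i : m n / (m <= n)%N}.
  move=> m n mn; apply/bigmax_leqP => -[l lm] _ /=.
  by apply: e_ge; apply: leq_trans mn.
have [edom|] := pselect (forall j, strictly_increasing j ->
    exists i K, forall k, (K <= k)%N -> (j k.+1 < e i (j k))%N).
  by eexists; exact: evasive_of_dominating emono edom.
move=> /existsNP[j /not_implyP[jS nj]].
(* Where [e i (j k) <= j k.+1], the word at [j k] fits in its slot. *)
apply: (evasive_of_slots _ _ y j jS) => // i K.
apply: contrapT => H; apply: nj; exists i, K => k Kk.
rewrite ltnNge; apply/negP => ek; apply: H; exists k; split=> //.
exact: leq_trans (e_ge _ _ _ (leqnn _)) ek.
Qed.

(** * From evasive functions to a winning strategy *)

(** If for every [n] some slalom of width [k.+1] met each [x i] beyond [n], the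
    union of the first [k.+1] of them at [k], of size [k.+1 ^ 2], would contradict
    evasiveness. So some [n] works against all slaloms; before round [n] the
    witness is [0] and Player II truthfully reports whether [0] is avoided, after
    that the answer is always [1]. *)
Lemma winning_II_of_evasive (I : Type) (x : I -> nat -> nat) :
  evasive (fun k => k.+1 ^ 2)%N x ->
  exists A : set (nat -> nat), II_has_winning A /\
    exists f : {x : nat -> nat | A x} -> I, injective f.
Proof.
move=> xev.
have [n nP] : exists n, forall a : nat -> seq nat, (forall k, size (a k) = k.+1) ->
    exists i, forall k, (n <= k)%N -> x i k \notin a k.
  apply: contrapT => /forallNP H.
  have /choice[a aP] n : exists a : nat -> seq nat, (forall k, size (a k) = k.+1) /\
      forall i, exists k, (n <= k)%N /\ x i k \in a k.
    have /existsNP[a /not_implyP[sa /forallNP ha]] := H n.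
    exists a; split=> // i; have /existsNP[k /not_implyP[nk /negP]] := ha i.
    by rewrite negbK => xa; exists k.
  have [|i [K iK]] := xev (fun k => flatten [seq a n k | n <- iota 0 k.+1]).
    move=> k; rewrite size_flatten sumnE !big_map.
    under eq_bigr do rewrite (aP _).1.
    by rewrite big_const_seq count_predT size_iota iter_addn_0 mulnn.
  have [k [Kk xk]] := (aP K).2 i.
  have /negP := iK k Kk; apply; apply/flattenP; exists (a K k) => //.
  by apply/mapP; exists K => //; rewrite mem_iota.
pose x' i k := if (k < n)%N then 0%N else x i k.
exists (range x'); split; last first.
  have /choice[f fP] (u : {u | range x' u}) : exists i, x' i = sval u.
    by case: (svalP u) => i _ iu; exists i.
  by exists f => u v uv; apply: eq_sig_hprop => [w|]; [exact: Prop_irrelevance|rewrite -!fP uv].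
(* The history at round [k] has [k.+1] entries, so [size s <= n] means [k < n], and [last] is the
   current move. *)
exists (fun s => if (size s <= n)%N then `[< ~ last set0 s 0%N >] else true) => a la.
have respE k : resp (fun s => if (size s <= n)%N then `[< ~ last set0 s 0%N >] else true) a k
    = if (k < n)%N then `[< ~ a k 0%N >] else true.
  by rewrite /resp size_mkseq -{2}[k.+1]addn1 /mkseq iotaD map_cat last_cat.
split.
  move=> m; exists (maxn m n); rewrite leq_maxl respE ifF //; lia.
have /choice[s sP] := la.
have [i ip] := nP s (fun k => (sP k).2.1).
exists (x' i); first by exists i.
move=> k; rewrite respE /x'; case: ltnP => nk; first by split=> /asboolP.
split=> // _; rewrite (sP k).2.2 /=.
by apply/negP; exact: ip.
Qed.

(** add(N)_game^II = cov(M), stated as equality of two minima of cardinals: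
    every witness for one side is dominated (via an injection) by a witness
    for the other side, and vice versa. *)
Theorem mainTheorem10 :
  (forall A : set (nat -> nat), II_has_winning A ->
     exists (I : Type) (M : I -> set cantor_space),
       (forall i, meager (M i)) /\ \bigcup_(i in [set: I]) M i = [set: cantor_space] /\
       exists f : I -> {x : nat -> nat | A x}, injective f) /\
  (forall (I : Type) (M : I -> set cantor_space),
     (forall i, meager (M i)) -> \bigcup_(i in [set: I]) M i = [set: cantor_space] ->
     exists A : set (nat -> nat), II_has_winning A /\
       exists f : {x : nat -> nat | A x} -> I, injective f).
Proof.
split; first exact: cover_of_winning_II.
move=> I M Mmeager Mcov.
have [x xev] := evasive_of_cover _ (fun k => k.+1 ^ 2)%N _ Mmeager Mcov.
exact: winning_II_of_evasive xev.
Qed.
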